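(* Let $p\ge1$, $n\ge1$ and $b\ge2$ be integers with $b\equiv1\pmod p$. Let $\{\kappa_r^+\}_{r\ge0}$ be the $(+b,n,p)$-carries process with $\kappa_0^+=0$, and let $\{\sigma_r\}_{r\ge0}$ be the Markov chain on $G_{p,n}$ obtained by repeated applications of $(+b,n,p)$-shuffles with $\sigma_0=\mathrm{id}$. Then the processes $\{\kappa_r^+\}_{r\ge0}$ and $\{d(\sigma_r)\}_{r\ge0}$ have the same distribution.
   Context: Carries process: $\mathcal D(b)=\{0,1,\dots,b-1\}$; $\mathcal C_p(n)=\{0,\dots,n-1\}$ if $p=1$ and $\{0,\dots,n\}$ if $p\ne1$. The $(+b,n,p)$-carries process is the Markov chain on $\mathcal C_p(n)$ in which, given $\kappa^+_{k-1}$, one draws $Y_1,\dots,Y_n$ independently and uniformly from $\mathcal D(b)$ (independently of the past), and $\kappa^+_k$ is determined by $\kappa^+_{k-1}+Y_1+\dots+Y_n+A_+(b)=\kappa_k^+b+s$ with $s\in\mathcal D(b)$, where $A_+(b)=(b-1)(1-\frac1p)$. Colored permutations: let $[n]=\{1,\dots,n\}$, $\Sigma=[n]\times\mathbf Z_p$ with $\mathbf Z_p=\mathbf Z/p\mathbf Z=\{0,\dots,p-1\}$, and for $q\in\mathbf Z_p$ let $T_q(i,r)=(i,r+q)$. $G_{p,n}$ is the group (under composition) of bijections $\sigma:\Sigma\to\Sigma$ with $\sigma\circ T_1=T_1\circ\sigma$. Write $(\sigma(i),\sigma^c(i)):=\sigma(i,0)$; $\sigma$ is determined by $((\sigma(1),\sigma^c(1)),\dots,(\sigma(n),\sigma^c(n)))$.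 Order and descents: $\Sigma$ is totally ordered by $(1,0)<\dots<(n,0)<(1,p-1)<\dots<(n,p-1)<(1,p-2)<\dots<(n,p-2)<\dots<(1,1)<\dots<(n,1)$. $\sigma\in G_{p,n}$ has a descent at $i\in\{1,\dots,n-1\}$ iff $(\sigma(i),\sigma^c(i))>(\sigma(i+1),\sigma^c(i+1))$, and a descent at $n$ iff $\sigma^c(n)\neq0$. $d(\sigma)$ is the number of descents of $\sigma$. Shuffle: for ${\bf A}=(a_1,\dots,a_n)\in\mathcal D(b)^n$ define $\pi_b[{\bf A}]=\sigma\in G_{p,n}$ by $\sigma(i)=\sharp\{j:a_j<a_i\}+\sharp\{j\le i:a_j=a_i\}$ and $\sigma^c(i)\equiv a_i\pmod p$. A $(+b,n,p)$-shuffle is the random element $\pi_b[{\bf A}]$ with ${\bf A}$ uniform on $\mathcal D(b)^n$. Repeated application means $\sigma_r=\pi_b[{\bf A}_r]\circ\cdots\circ\pi_b[{\bf A}_1]$ with ${\bf A}_1,{\bf A}_2,\dots$ independent and uniform on $\mathcal D(b)^n$. *)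

(* Defs.v *)
From HB Require Import structures.
From mathcomp Require Import all_boot all_order all_fingroup all_algebra finmap.
From mathcomp Require Import all_classical all_reals all_analysis.
Set Implicit Arguments. Unset Strict Implicit. Unset Printing Implicit Defensive.
Import Order.TTheory GRing.Theory Num.Theory.

Local Open Scope ring_scope.

(** * Colored permutations

    For [0 < p], ['I_p.-1.+1] is [{0, ..., p-1}] with its library structure of
    additive group modulo [p]; unlike ['Z_p] it is also correct for [p = 1].
    Elements of [[n] = {1, ..., n}] are represented by ['I_n], shifted by one. *)

Notation color p := 'I_p.-1.+1.
Notation Sigma p n := ('I_n * color p)%type.

Definition shift_color (p n : nat) (q : color p) (x : Sigma p n) : Sigma p n :=
  (x.1, x.2 + q).

Definition colored_perm (p n : nat) : {set {perm Sigma p n}} :=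
  [set s : {perm Sigma p n} |
    [forall x, s (shift_color (inZp 1) x) == shift_color (inZp 1) (s x)]].

Lemma colored_permP (p n : nat) (s : {perm Sigma p n}) :
  reflect (forall x, s (shift_color (inZp 1) x) = shift_color (inZp 1) (s x))
          (s \in colored_perm p n).
Proof. by rewrite inE; exact: 'forall_eqP. Qed.

Lemma colored_perm_group_set (p n : nat) : group_set (colored_perm p n).
Proof.
apply/group_setP; split=> [|s t /colored_permP hs /colored_permP ht].
  by apply/colored_permP=> x; rewrite !perm1.
by apply/colored_permP=> x; rewrite !permM hs ht.
Qed.

Canonical colored_perm_group (p n : nat) : {group {perm Sigma p n}} :=
  Group (colored_perm_group_set p n).

Notation Gpn p n := [subg (colored_perm_group p n)].

(* The colors are ordered 0 < p-1 < p-2 < ... < 1, i.e. by the representative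
   of [- r] in {0, ..., p-1}. *)
Definition Sigma_lt (p n : nat) (x y : Sigma p n) : bool :=
  ((- x.2 : color p) < (- y.2 : color p))%N || (x.2 == y.2) && (x.1 < y.1)%N.

(* [insub i.+1] is [None] exactly when [i] is the last index. *)
Definition descent (p n : nat) (s : {perm Sigma p n}) (i : 'I_n) : bool :=
  if insub i.+1 is Some j then Sigma_lt (s (j, 0)) (s (i, 0))
  else (s (i, 0)).2 != 0.

Definition descents (p n : nat) (s : Gpn p n) : nat :=
  #|[set i : 'I_n | descent (sgval s) i]|.

(** * Shuffles *)

(* The second set has [j < i] instead of [j <= i] because positions start
   at 0 here. *)
Definition shuffle_pos (n b : nat) (A : {ffun 'I_n -> 'I_b}) (i : 'I_n) : nat :=
  (#|[set j : 'I_n | (A j < A i)%N]| +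
   #|[set j : 'I_n | (j < i)%N && (A j == A i)]|)%N.

Definition shuffle_lt (n b : nat) (A : {ffun 'I_n -> 'I_b}) (j i : 'I_n) : bool :=
  (A j < A i)%N || (j < i)%N && (A j == A i).

Lemma shuffle_posE (n b : nat) (A : {ffun 'I_n -> 'I_b}) (i : 'I_n) :
  shuffle_pos A i = #|[set j | shuffle_lt A j i]|.
Proof.
rewrite /shuffle_pos -cardsUI.
rewrite (_ : _ :&: _ = finset.set0) ?cards0 ?addn0.
  by congr #|pred_of_set _|; apply/setP=> j; rewrite !inE.
apply/setP=> j; rewrite !inE; apply/negP=> /and3P[+ _ /eqP e].
by rewrite e ltnn.
Qed.

Lemma shuffle_lt_trans (n b : nat) (A : {ffun 'I_n -> 'I_b}) :
  transitive (shuffle_lt A).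
Proof.
move=> j i k /orP[ij|/andP[ij /eqP eij]] /orP[jk|/andP[jk /eqP ejk]].
- by rewrite /shuffle_lt (ltn_trans ij jk).
- by rewrite /shuffle_lt -ejk ij.
- by rewrite /shuffle_lt eij jk.
- by rewrite /shuffle_lt (ltn_trans ij jk) eij ejk eqxx orbT.
Qed.

Lemma shuffle_lt_irr (n b : nat) (A : {ffun 'I_n -> 'I_b}) :
  irreflexive (shuffle_lt A).
Proof. by move=> i; rewrite /shuffle_lt !ltnn. Qed.

Lemma shuffle_pos_ltn (n b : nat) (A : {ffun 'I_n -> 'I_b}) (i : 'I_n) :
  (shuffle_pos A i < n)%N.
Proof.
rewrite shuffle_posE -[X in (_ < X)%N]card_ord -cardsT.
apply: proper_card; apply/properP; split; first exact: finset.subsetT.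
by exists i; rewrite !inE // shuffle_lt_irr.
Qed.

Lemma shuffle_pos_homo (n b : nat) (A : {ffun 'I_n -> 'I_b}) (j i : 'I_n) :
  shuffle_lt A j i -> (shuffle_pos A j < shuffle_pos A i)%N.
Proof.
move=> ji; rewrite !shuffle_posE; apply: proper_card; apply/properP; split.
  by apply/fintype.subsetP=> k; rewrite !inE => kj; exact: shuffle_lt_trans ji.
by exists j; rewrite !inE // shuffle_lt_irr.
Qed.

Lemma shuffle_pos_inj (n b : nat) (A : {ffun 'I_n -> 'I_b}) :
  injective (shuffle_pos A).
Proof.
move=> i j eij; apply/eqP; apply/negPn/negP=> nij.
suff: shuffle_lt A i j || shuffle_lt A j i.
  by case/orP=> /shuffle_pos_homo; rewrite eij ltnn.
rewrite /shuffle_lt; case: (ltngtP (A i) (A j)) => //=; rewrite ?orbT //.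
move=> /ord_inj ->.
by rewrite eqxx !andbT -neq_ltn.
Qed.

Definition shuffle_fun (p n b : nat) (A : {ffun 'I_n -> 'I_b}) (x : Sigma p n) :
    Sigma p n :=
  (Ordinal (shuffle_pos_ltn A x.1), x.2 + inZp (A x.1)).

Lemma shuffle_fun_inj (p n b : nat) (A : {ffun 'I_n -> 'I_b}) :
  injective (@shuffle_fun p n b A).
Proof.
case=> [i r] [j t] e.
have /shuffle_pos_inj eij : shuffle_pos A i = shuffle_pos A j.
  by have := congr1 (fun x => nat_of_ord x.1) e.
by move: (congr1 snd e); rewrite eij /= => /addIr ->.
Qed.

Lemma shuffle_in (p n b : nat) (A : {ffun 'I_n -> 'I_b}) :
  perm (@shuffle_fun_inj p n b A) \in colored_perm_group p n.
Proof.
apply/colored_permP=> -[i r]; rewrite !permE /shuffle_fun /shift_color /=.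
by congr pair; rewrite addrAC.
Qed.

Definition shuffle (p n b : nat) (A : {ffun 'I_n -> 'I_b}) : Gpn p n :=
  Subg (@shuffle_in p n b A).

(** * Discrete random variables *)

Local Open Scope classical_set_scope.

Section Probability.
Context {d : measure_display} {Omega : measurableType d} {R : realType}.
Variable P : probability Omega R.

(* Values are taken in [V] with the discrete sigma-algebra. *)
Definition discrete_rv {V : Type} (X : Omega -> V) : Prop :=
  forall B : set V, measurable (X @^-1` B).

Definition uniform_rv {V : finType} (X : Omega -> V) : Prop :=
  discrete_rv X /\ forall v : V, P (X @^-1` [set v]) = (#|V|%:R^-1)%:E.

Definition mutually_independent {I : choiceType} {V : Type}
    (X : I -> Omega -> V) : Prop :=
  forall (J : {fset I}) (B : I -> set V),
    P (\bigcap_(i in [set` J]) (X i @^-1` B i)) =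
    (\prod_(i <- J) P (X i @^-1` B i))%E.

Definition independent_rv {V W : Type} (X : Omega -> V) (Y : Omega -> W) : Prop :=
  forall (B : set V) (C : set W),
    P (X @^-1` B `&` Y @^-1` C) = (P (X @^-1` B) * P (Y @^-1` C))%E.

End Probability.

(** * The two processes *)

Definition A_plus (p b : nat) : rat := (b%:R - 1) * (1 - p%:R^-1).

Definition carry_states (p n : nat) : nat := if p == 1%N then n else n.+1.

Notation carry_state p n := 'I_(carry_states p n).

(* [Y k] is the family drawn for the step from time [k] to time [k.+1]. *)
Definition carries_process (p n b : nat) {d : measure_display}
    {Omega : measurableType d} {R : realType} (P : probability Omega R)
    (kappa : nat -> Omega -> carry_state p n) : Prop :=
  (forall k, discrete_rv (kappa k)) /\
  exists Y : nat -> 'I_n -> Omega -> 'I_b,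
    forall k : nat,
    [/\ forall i, uniform_rv P (Y k i),
        mutually_independent P (Y k),
        independent_rv P (fun w => [ffun j : 'I_k.+1 => kappa j w])
                         (fun w => [ffun i => Y k i w])
      & forall w, exists s : 'I_b,
          (kappa k w)%:R + \sum_(i < n) (Y k i w)%:R + A_plus p b =
          (kappa k.+1 w)%:R * b%:R + s%:R :> rat].

(* In a permutation group [s * t] means "first s, then t", so the last line
   reads sigma_(r+1) = shuffle (A_r) o sigma_r. *)
Definition shuffle_chain (p n b : nat) {d : measure_display}
    {Omega : measurableType d} {R : realType} (P : probability Omega R)
    (sigma : nat -> Omega -> Gpn p n) : Prop :=
  exists A : nat -> Omega -> {ffun 'I_n -> 'I_b},
    [/\ forall r, uniform_rv P (A r),
        mutually_independent P A,
        forall w, sigma 0%N w = 1%g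
      & forall r w, sigma r.+1 w = (sigma r w * shuffle p (A r w))%g].

(** * Equality in law of processes *)

Definition path_measurable (V : Type) : set (set (nat -> V)) :=
  <<s [set C | exists (r : nat) (B : set V), C = [set x | B (x r)]] >>.

Definition same_distribution {V : Type} {R : realType}
    {d : measure_display} {Omega : measurableType d} (P : probability Omega R)
    (X : nat -> Omega -> V)
    {d' : measure_display} {Omega' : measurableType d'} (P' : probability Omega' R)
    (X' : nat -> Omega' -> V) : Prop :=
  forall B : set (nat -> V), path_measurable B ->
    P [set w | B (fun r => X r w)] = P' [set w | B (fun r => X' r w)].

(* Main.v *)
Require Import Defs.
From mathcomp Require Import all_boot all_order all_fingroup all_algebra finmap.
From mathcomp Require Import zify ring.
From mathcomp Require Import all_classical all_reals all_analysis.

(** Why the two processes have the same law.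

    Write [b.+1] and [n.+1] for the parameters of the theorem.  Composing [k]
    shuffles is one shuffle of a larger base: if the card that starts at
    position [i] is given, as its [r]-th digit, the digit that the [r]-th
    shuffle assigns to the position where that card then lies, its label is a
    number below [B = b.+1 ^ k], the cards end up sorted by label (ties by
    initial position), and, as [b.+1] is [1] modulo [p], the color of a card is
    its label modulo [p] ([card_at_lt], [card_at_color]).

    The order on colored cards is the order of another number.  Multiplying
    labels by the inverse of [p] modulo [B] is a bijection of [{0, ..., B-1}]
    that sorts them first by the opposite of the color and then by the label
    ([ltn_color_rank]).  With [L i] the image of the label of [i], descents at
    [i] other than the last index are the [i] with [L i.+1 < L i], and there is
    a descent at the last index exactly when [L n + m (p-1)] reaches [B], where
    [m = (B-1)/p] ([descents_rank_label]).

    Such descents are carries.  Add the successive differences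
    [M i = L i - L (i-1)], reduced modulo [B]: the running sums are the [L i]
    modulo [B], and [B] is passed once for each descent of [L]; adding
    [m (p-1)], whose base [b.+1] digits are all equal to the constant
    [b (p-1)/p] of the carries process, passes [B] once more exactly for the
    last descent.  Hence the number of descents after [k] shuffles is the carry
    out of column [k] in the addition of the [M i] ([descents_carry]).

    All these numbers for [k] shuffles reduce modulo [b.+1 ^ r] to those for the
    first [r] shuffles, so one sequence of digits of the [M i] produces the whole
    trajectory, and the digits of the shuffles can be recovered from it
    ([addends_inj]).  This is a bijection of the finite set of digit families,
    which yields equality of the numbers of families with a given trajectory
    ([card_descents_carry]).

    On the probability side, each finite-dimensional law is such a number over
    the total number of families ([law_descents], [law_carries]), and
    finite-dimensional laws determine the law of a process
    ([same_distribution_past]). *)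

Set Implicit Arguments. Unset Strict Implicit. Unset Printing Implicit Defensive.

(** * Division by p modulo pm+1 and the order of colors *)

Section ColorRank.
Variables p m : nat.
Hypothesis p_gt0 : 0 < p.

(** The factor [m * p.-1 + 1] is the inverse of [p] modulo [p * m + 1]. *)
Definition color_rank (N : nat) : nat := (N * (m * p.-1).+1) %% (p * m).+1.

Definition neg_color (N : nat) : nat := (p - N %% p) %% p.

Lemma neg_color_cases N :
  N %% p = 0 /\ neg_color N = 0 \/ 0 < N %% p /\ neg_color N = p - N %% p.
Proof.
rewrite /neg_color; case: (posnP (N %% p)) => [->|c0].
  by left; rewrite subn0 modnn.
by right; rewrite modn_small //; lia.
Qed.

(** Exact division is possible after adding to [N] the multiple
    [e (p m + 1)] of the modulus, where [e] is the opposite of the color of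
    [N]; the quotient is the right-hand side. *)
Lemma color_rankE N : N < (p * m).+1 ->
  color_rank N = N %/ p + (0 < neg_color N) + neg_color N * m.
Proof.
move=> ltN; rewrite /color_rank.
have eN := divn_eq N p; have lc := ltn_pmod N p_gt0.
set q := N %/ p in eN *; set c := N %% p in eN lc *.
have ep : p = p.-1.+1 by lia.
case: (neg_color_cases N) => -[]; rewrite -/c => c0 ->.
  rewrite mul0n !addn0.
  have -> : N * (m * p.-1).+1 = q * p.-1 * (p * m).+1 + q.
    rewrite eN c0; nia.
  by rewrite modnMDl modn_small //; nia.
have -> : 0 < p - c by lia.
have ->: N * (m * p.-1).+1 = (q * p.-1 + c.-1) * (p * m).+1 + (q + 1 + (p - c) * m).
  have [r er] : exists r, p = c + r by exists (p - c); lia.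
  rewrite eN [in LHS]ep.
  have [c' ec] : exists c', c = c'.+1 by exists c.-1; lia.
  have -> : p - c = r by lia.
  rewrite ec er ec /=; nia.
rewrite modnMDl modn_small //.
have : q < m by nia.
nia.
Qed.

(** Each value of [neg_color] occupies an interval of ranks: [0, ..., m] for
    the value [0], and then consecutive intervals of length [m]. *)
Lemma color_rank_bounds N : N < (p * m).+1 ->
  neg_color N * m + (0 < neg_color N) <= color_rank N <= (neg_color N).+1 * m.
Proof.
move=> ltN; rewrite color_rankE //.
have eN := divn_eq N p; have lc := ltn_pmod N p_gt0.
case: (neg_color_cases N) => -[] c0 ->; first nia.
have -> : 0 < p - N %% p by lia.
have : N %/ p < m by nia.
nia.
Qed.

Lemma ltn_color_rank N N' : N < (p * m).+1 -> N' < (p * m).+1 ->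
  (color_rank N < color_rank N') =
  (neg_color N < neg_color N') || (neg_color N == neg_color N') && (N < N').
Proof.
move=> ltN ltN'.
have := color_rank_bounds ltN; have := color_rank_bounds ltN'.
have [e|e|e] := ltngtP (neg_color N) (neg_color N') => /=; try by case: posnP; nia.
move=> _ _; rewrite !color_rankE // e.
have eN := divn_eq N p; have eN' := divn_eq N' p.
have lc := ltn_pmod N p_gt0; have lc' := ltn_pmod N' p_gt0.
have : N %% p = N' %% p.
  by case: (neg_color_cases N) => -[]; case: (neg_color_cases N') => -[]; lia.
nia.
Qed.

(** The ranks of the labels of color [0] are those up to [m], and
    [p m + 1 - m (p-1) = m + 1]. *)
Lemma color_rank_carry N : N < (p * m).+1 ->
  ((p * m).+1 <= color_rank N + m * p.-1) = (N %% p != 0).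
Proof.
move=> ltN; have := color_rank_bounds ltN.
by case: (neg_color_cases N) => -[] c0 ->; nia.
Qed.

Lemma color_rank_lt N : color_rank N < (p * m).+1.
Proof. exact: ltn_pmod. Qed.

Lemma color_rankK N : N < (p * m).+1 -> color_rank N * p %% (p * m).+1 = N.
Proof.
move=> ltN; rewrite /color_rank modnMml.
have -> : N * (m * p.-1).+1 * p = N * p.-1 * (p * m).+1 + N by nia.
by rewrite modnMDl modn_small.
Qed.

End ColorRank.

(** * Cyclic increments *)

(** The increments modulo [B] telescope, except that each strict decrease of
    [l] contributes one more [B]. *)
Lemma sum_cyclic_increments (B n : nat) (l : nat -> nat) :
  (forall i, l i < B) ->
  \sum_(i < n.+1) (l i + (B - (if i : nat is j.+1 then l j else 0))) %% B =
  l n + B * \sum_(i < n) (l i.+1 < l i).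
Proof.
move=> ltlB; elim: n => [|n IHn].
  by rewrite big_ord_recr !big_ord0 /= subn0 modnDr modn_small // muln0 addn0.
rewrite big_ord_recr [in RHS]big_ord_recr /= IHn mulnDr.
have ltBn := ltlB n; have ltBn1 := ltlB n.+1.
have [lt|ge] := ltnP (l n.+1) (l n).
  by rewrite muln1 modn_small; last lia; set S := B * _; lia.
have -> : l n.+1 + (B - l n) = l n.+1 - l n + B by lia.
by rewrite muln0 addn0 modnDr modn_small; last lia; set S := B * _; lia.
Qed.

Lemma ltn_lexi_digits B d d' l l' : l < B -> l' < B ->
  (d * B + l < d' * B + l') = (d < d') || (d == d') && (l < l').
Proof. by move=> ltl ltl'; have [||->] := ltngtP d d' => /=; nia. Qed.

(** * Histories of shuffles and of carries *)

(** Histories are lists with the newest item first, so that the past of a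
    history is its tail and its trajectory is a map over its suffixes. *)
Fixpoint suffix_map (S T : Type) (f : seq S -> T) (s : seq S) : seq T :=
  f s :: if s is _ :: s' then suffix_map f s' else [::].

Section Histories.
Variables p n b : nat.
Hypotheses (p_gt0 : 0 < p) (p_dvd_b : p %| b).

Notation V := {ffun 'I_n.+1 -> 'I_b.+1}.
Implicit Types (s t : seq V) (a y : V) (i j : 'I_n.+1).

(** The number of labels below [b.+1 ^ k] of each nonzero color. *)
Definition color_block k := (b.+1 ^ k).-1 %/ p.

Lemma color_blockK k : (p * color_block k).+1 = b.+1 ^ k.
Proof.
rewrite mulnC divnK ?prednK ?expn_gt0 // -subn1 -eqn_mod_dvd ?expn_gt0 //.
by rewrite -modnXm -addn1 -modnDml (eqP p_dvd_b) add0n modnXm exp1n.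
Qed.

Lemma color_blockS k : color_block k.+1 = b %/ p * b.+1 ^ k + color_block k.
Proof.
apply/eqP; rewrite -(eqn_pmul2l p_gt0) mulnDr mulnA [p * (b %/ p)]mulnC divnK //.
by rewrite -eqSS -addnS !color_blockK expnS mulSn addnC.
Qed.

Lemma dvdn_scale k : b.+1 ^ k %| b.+1 ^ k.+1.
Proof. by rewrite expnS dvdn_mull. Qed.

Fixpoint shuffle_prod s : Gpn p n.+1 :=
  if s is a :: s' then (shuffle_prod s' * shuffle p a)%g else 1%g.

Definition card_at s i : Sigma p n.+1 := sgval (shuffle_prod s) (i, 0%R).

Lemma card_at_cons a s i : let x := card_at s i in
  card_at (a :: s) i = (Ordinal (shuffle_pos_ltn a x.1), (x.2 + inZp (a x.1))%R).
Proof. by rewrite /card_at /= permM permE. Qed.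

(** The new digit is read at the current position of the card, not at its
    initial position: this is what makes the labels sort the cards. *)
Fixpoint label s i : nat :=
  if s is a :: s' then a (card_at s' i).1 * b.+1 ^ size s' + label s' i else 0.

Lemma label_lt s i : label s i < b.+1 ^ size s.
Proof.
elim: s => //= a s; have := ltn_ord (a (card_at s i).1); rewrite expnS.
nia.
Qed.

Lemma shuffle_pos_lt a i j :
  (shuffle_pos a i < shuffle_pos a j) = shuffle_lt a i j.
Proof.
apply/idP/idP => [lt|]; last exact: shuffle_pos_homo.
have := @shuffle_pos_homo _ _ a j i; rewrite /shuffle_lt.
case: (ltngtP (a i) (a j)) => //= [_ /(_ isT)|/ord_inj eqa]; first by lia.
rewrite eqa eqxx !andbT; case: (ltngtP i j) => // [_ /(_ isT)|/ord_inj eij]; first lia.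
by move: lt; rewrite eij ltnn.
Qed.

(** The last shuffle sorts by its own digit, which is the leading digit of the
    label, and breaks ties by the preceding position; sorting by digits from
    the least significant one sorts by label. *)
Lemma card_at_lt s i j : ((card_at s i).1 < (card_at s j).1) =
  (label s i < label s j) || (label s i == label s j) && (i < j).
Proof.
elim: s i j => [|a s IHs] i j; first by rewrite /card_at /= !perm1.
rewrite !card_at_cons /= shuffle_pos_lt /shuffle_lt IHs.
have := label_lt s i; have := label_lt s j.
set x := (card_at s i).1; set x' := (card_at s j).1; move=> lj li.
rewrite -(inj_eq val_inj) /= ltn_lexi_digits //.
have [|gt|->] := ltngtP (a x) (a x') => //=; first by rewrite andbF /= gtn_eqF //; nia.
by rewrite andbT eqn_add2l.
Qed.

(** The weights [b.+1 ^ r] of the digits are all [1] modulo [p]. *)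
Lemma card_at_color s i : (card_at s i).2 = inZp (label s i).
Proof.
elim: s => [|a s IHs]; first by rewrite /card_at /= perm1; apply: val_inj; rewrite /= mod0n.
rewrite card_at_cons /= IHs; move: (card_at s i).1 => x; apply: val_inj => /=.
rewrite prednK // -color_blockK modnDm mulnS mulnCA [p * _]mulnC [a x + _]addnC.
by rewrite -addnA modnMDl addnC.
Qed.

Lemma card_at_inj s : injective (fun i => (card_at s i).1).
Proof.
move=> i j eij; have := card_at_lt s i j; have := card_at_lt s j i.
rewrite eij !ltnn; case: (ltngtP (label s i) (label s j)) => //= _.
by case: (ltngtP i j) => // /ord_inj.
Qed.

(** Indexed by [nat], because consecutive indices are compared and
    subtracted. *)
Definition rank_label s (i : nat) : nat :=
  color_rank p (color_block (size s)) (label s (inord i)).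

Lemma rank_label_lt s (i : nat) : rank_label s i < b.+1 ^ size s.
Proof. by rewrite -color_blockK color_rank_lt. Qed.

Lemma val_opp_inZp x : (- (inZp x : color p))%R = neg_color p x :> nat.
Proof. by rewrite /= /neg_color prednK // modn_mod. Qed.

Lemma Sigma_lt_card_at s i j : i < j ->
  Sigma_lt (card_at s j) (card_at s i) = (rank_label s j < rank_label s i).
Proof.
move=> ltij; rewrite /rank_label !inord_val ltn_color_rank ?color_blockK ?label_lt //.
rewrite /Sigma_lt !card_at_color card_at_lt !val_opp_inZp; congr orb.
rewrite [j < i]ltnNge (ltnW ltij) andbF orbF; congr andb.
rewrite -val_eqE /= prednK // /neg_color.
set c := _ %% p; set c' := _ %% p.
have lc : c < p by rewrite ltn_pmod. have lc' : c' < p by rewrite ltn_pmod.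
apply/eqP/eqP => [->//|].
case: (posnP c) => [->|c0]; case: (posnP c') => [->|c0'] //; rewrite ?subn0 ?modnn.
- by rewrite modn_small; lia.
- by rewrite modn_small; lia.
- by rewrite !modn_small; lia.
Qed.

Lemma descents_rank_label s : descents (shuffle_prod s) =
  \sum_(i < n) (rank_label s i.+1 < rank_label s i) +
  (b.+1 ^ size s <= rank_label s n + color_block (size s) * p.-1).
Proof.
rewrite /descents -sum1dep_card big_mkcond big_ord_recr /=; congr (_ + _).
  apply: eq_bigr => i _; rewrite /descent /=.
  have lti : i.+1 < n.+1 by rewrite ltnS.
  by rewrite (insubT (fun k => k < n.+1) lti) -!/(card_at s _) Sigma_lt_card_at //=.
rewrite /descent insubF /= ?ltnn // -/(card_at s _) card_at_color.
rewrite -color_blockK /rank_label color_rank_carry ?color_blockK ?label_lt //.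
have -> : inord n = ord_max :> 'I_n.+1 by apply: val_inj; rewrite /= inordK.
by rewrite -val_eqE /= prednK //.
Qed.

(** Both the label and the factor of [color_rank] only gain multiples of
    [b.+1 ^ size s]. *)
Lemma rank_label_cons_mod a s (i : nat) :
  rank_label (a :: s) i = rank_label s i %[mod b.+1 ^ size s].
Proof.
rewrite /rank_label /color_rank !color_blockK modn_mod modn_dvdm ?dvdn_scale //.
rewrite -modnMml [label (a :: s) _]/= modnMDl modnMml -[LHS]modnMmr -[RHS]modnMmr.
by rewrite color_blockS mulnDl -addnS mulnAC modnMDl.
Qed.

Definition increment s (i : nat) : nat :=
  (rank_label s i +
   (b.+1 ^ size s - (if i is j.+1 then rank_label s j else 0))) %% b.+1 ^ size s.

Lemma increment_lt s (i : nat) : increment s i < b.+1 ^ size s.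
Proof. by rewrite ltn_mod expn_gt0. Qed.

Lemma increment_cons_mod a s (i : nat) :
  increment (a :: s) i %% b.+1 ^ size s = increment s i.
Proof.
rewrite -[RHS]modn_mod /increment modn_dvdm ?dvdn_scale //.
rewrite modn_mod.
case: i => [|j] /=.
  rewrite !subn0 -modnDmr (eqP (dvdn_scale _)) addn0 modnDr.
  exact: rank_label_cons_mod.
have := rank_label_lt (a :: s) j; have := rank_label_lt s j => lt lt'.
apply/eqP; rewrite -(eqn_modDr (rank_label s j)).
rewrite -[X in X == _]modnDmr -(rank_label_cons_mod a) modnDmr -!addnA.
rewrite !subnK 1?ltnW // modnDr -modnDmr (eqP (dvdn_scale _)) addn0.
by rewrite rank_label_cons_mod.
Qed.

Lemma sum_increment s : \sum_(i < n.+1) increment s i =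
  rank_label s n + b.+1 ^ size s * \sum_(i < n) (rank_label s i.+1 < rank_label s i).
Proof. by rewrite -sum_cyclic_increments //; exact: rank_label_lt. Qed.

(** The newest addend is the leading digit of the increments; the older ones
    are those of the tail because increments are compatible with reduction. *)
Fixpoint addends s : seq V :=
  if s is _ :: s' then
    [ffun i : 'I_n.+1 => inord (increment s i %/ b.+1 ^ size s')] :: addends s'
  else [::].

Lemma size_addends s : size (addends s) = size s.
Proof. by elim: s => //= a s ->. Qed.

Fixpoint addend_value t i : nat :=
  if t is y :: t' then y i * b.+1 ^ size t' + addend_value t' i else 0.

Lemma addend_value_addends s i : addend_value (addends s) i = increment s i.
Proof.
elim: s => [|a s IHs]; first by rewrite /increment expn0 modn1.
rewrite [addends _]/= /= size_addends IHs -(increment_cons_mod a) ffunE.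
rewrite inordK -?divn_eq // ltn_divLR ?expn_gt0 //.
by have := increment_lt (a :: s) i; rewrite expnS.
Qed.

Definition carry_step c y : nat :=
  (c + \sum_(i < n.+1) y i + b %/ p * p.-1) %/ b.+1.

Fixpoint carry t : nat := if t is y :: t' then carry_step (carry t') y else 0.

(** Adding column by column, with the carries passed on, is adding the
    numbers. *)
Lemma carryE t : carry t =
  (\sum_(i < n.+1) addend_value t i + color_block (size t) * p.-1) %/ b.+1 ^ size t.
Proof.
elim: t => [|y t IHt]; first by rewrite /= big1 // /color_block div0n.
rewrite /= color_blockS big_split /= -big_distrl /= /carry_step IHt.
have B0 : 0 < b.+1 ^ size t by rewrite expn_gt0.
set S := \sum_i addend_value t i; set T := \sum_(_ < _) _.
rewrite expnSr divnMA.
have -> : T * b.+1 ^ size t + S + (b %/ p * b.+1 ^ size t + color_block (size t)) * p.-1 =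
  (T + b %/ p * p.-1) * b.+1 ^ size t + (S + color_block (size t) * p.-1) by nia.
by rewrite divnMDl // [in RHS]addnC addnA.
Qed.

Lemma descents_carry s : descents (shuffle_prod s) = carry (addends s).
Proof.
rewrite carryE size_addends (eq_bigr _ (fun i _ => addend_value_addends s i)).
rewrite sum_increment descents_rank_label [_ ^ _ * _]mulnC -addnA addnCA divnMDl ?expn_gt0 //.
congr (_ + _).
have := rank_label_lt s n; have := color_blockK (size s).
set B := _ ^ _; set r := rank_label s n; move=> eB ltr.
have [le|lt] := leqP B; last by rewrite divn_small.
(* Both summands are below [B], so the quotient is at most 1. *)
have lt : r + color_block (size s) * p.-1 - B < B by nia.
by rewrite -(subnK le) divnDr ?dvdnn // divnn divn_small //; lia.
Qed.

Lemma increment_inj s s' : size s = size s' ->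
  (forall i : 'I_n.+1, increment s i = increment s' i) ->
  forall i : nat, i < n.+1 -> rank_label s i = rank_label s' i.
Proof.
move=> eqsz eqinc.
have lt (i : nat) := rank_label_lt s i; have lt' (i : nat) := rank_label_lt s' i.
have {}eqinc (i : nat) : i < n.+1 -> increment s i = increment s' i.
  by move=> lti; exact: (eqinc (Ordinal lti)).
rewrite -eqsz in lt'.
have key (i x : nat) : rank_label s i + x = rank_label s' i + x %[mod b.+1 ^ size s] ->
    rank_label s i = rank_label s' i.
  by move/eqP; rewrite eqn_modDr !modn_small // => /eqP.
elim=> [|i IHi] lti; have := eqinc _ lti; rewrite /increment -eqsz.
  exact: key.
by rewrite IHi 1?ltnW //; exact: key.
Qed.

Lemma rank_label_inj s s' (i : nat) : size s = size s' -> i < n.+1 ->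
  rank_label s i = rank_label s' i -> label s (inord i) = label s' (inord i).
Proof.
move=> eqsz lti; rewrite /rank_label -eqsz => eqr.
rewrite -(@color_rankK p (color_block (size s)) _ (label s _)) ?color_blockK ?label_lt //.
rewrite -[label s' _](@color_rankK p (color_block (size s))) ?color_blockK ?eqsz ?label_lt // -eqsz.
by rewrite -color_blockK eqr.
Qed.

(** The trailing digits of the labels determine the older shuffles, hence the
    current positions of the cards; these take all values, so the leading
    digits determine the newest shuffle everywhere. *)
Lemma label_inj s s' : size s = size s' -> label s =1 label s' -> s = s'.
Proof.
elim: s s' => [|a s IHs] [|a' s'] //= [eqsz] eql.
have digits i : a (card_at s i).1 = a' (card_at s' i).1 /\ label s i = label s' i.
  have := eql i; rewrite -eqsz => e.
  have ll := label_lt s i; have := label_lt s' i; rewrite -eqsz => ll'.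
  have B0 : 0 < b.+1 ^ size s by rewrite expn_gt0.
  split; last by have := congr1 (modn^~ (b.+1 ^ size s)) e; rewrite /= !modnMDl !modn_small.
  apply: ord_inj; have := congr1 (divn^~ (b.+1 ^ size s)) e.
  by rewrite /= !divnMDl // !divn_small // !addn0.
have es : s = s' by apply: IHs => // i; have [] := digits i.
rewrite -es in digits eqsz *; congr (_ :: _); apply/ffunP=> x.
have [f fK Kf] := injF_bij (@card_at_inj s).
by have [] := digits (f x); rewrite Kf.
Qed.

Lemma addends_inj s s' : size s = size s' -> addends s = addends s' -> s = s'.
Proof.
move=> eqsz eqad; apply: label_inj => // i; rewrite -(inord_val i).
apply: rank_label_inj => //; apply: increment_inj => // j.
by rewrite -!addend_value_addends eqad.
Qed.

Lemma suffix_map_descents s :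
  suffix_map (fun s => descents (shuffle_prod s)) s = suffix_map carry (addends s).
Proof. by elim: s => [|a s IHs]; congr (_ :: _) => //; exact: descents_carry. Qed.

Lemma card_descents_carry k (E : pred (seq nat)) :
  #|[pred t : k.-tuple V | E (suffix_map (fun s => descents (shuffle_prod s)) t)]| =
  #|[pred t : k.-tuple V | E (suffix_map carry t)]|.
Proof.
have szP (t : k.-tuple V) : size (addends t) == k by rewrite size_addends size_tuple.
pose F (t : k.-tuple V) := Tuple (szP t).
have F_inj : injective F.
  move=> t t' /(congr1 val) /= /addends_inj eqt; apply: val_inj; apply: eqt.
  by rewrite !size_tuple.
rewrite -[RHS](on_card_preimset (onW_bij _ (injF_bij F_inj))).
rewrite cardsE; apply: eq_card => t.
by rewrite !inE suffix_map_descents.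
Qed.

End Histories.

(** * Past of a sequence *)

(** The first [k] terms, newest first. *)
Definition past (T : Type) (X : nat -> T) k : seq T := rev (mkseq X k).

Lemma pastS (T : Type) (X : nat -> T) k : past X k.+1 = X k :: past X k.
Proof. by rewrite /past mkseqS rev_rcons. Qed.

Lemma size_past (T : Type) (X : nat -> T) k : size (past X k) = k.
Proof. by rewrite size_rev size_mkseq. Qed.

Lemma eq_past (T : Type) (X X' : nat -> T) k :
  (forall j, j < k -> X j = X' j) -> past X k = past X' k.
Proof.
elim: k => [|k IHk] eqX //; rewrite !pastS eqX // IHk // => j ltj.
by rewrite eqX // ltnW.
Qed.

Lemma drop_past (T : Type) (X : nat -> T) k m : k <= m ->
  drop (m - k) (past X m) = past X k.
Proof.
elim: m => [|m IHm]; first by rewrite leqn0 => /eqP ->.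
rewrite leq_eqVlt => /predU1P[->|ltkm]; first by rewrite subnn drop0.
by rewrite subSn // pastS -IHm.
Qed.

Lemma card_tuple_cons (V : finType) k (Q : pred (seq V)) :
  #|[pred t : k.+1.-tuple V | Q t]| = \sum_y #|[pred t : k.-tuple V | Q (y :: t)]|.
Proof.
rewrite -sum1_card; under [RHS]eq_bigr => y _ do rewrite -sum1_card.
rewrite pair_big_dep /=.
apply: (reindex (fun yt : V * k.-tuple V => [tuple of yt.1 :: yt.2])).
exists (fun t => (thead t, [tuple of behead t])) => [[y t] _|t _] /=.
  by congr pair; apply: val_inj.
by apply: val_inj; rewrite /= [in RHS](tuple_eta t).
Qed.

(** * Discrete random variables and recursive chains *)

Section Laws.
Import Order.TTheory GRing.Theory Num.Theory.
Local Open Scope ring_scope.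
Local Open Scope classical_set_scope.
Context {d : measure_display} {Omega : measurableType d} {R : realType}.
Variable P : probability Omega R.

Lemma fiber_decomposition {V : Type} (X : Omega -> V) (F : set Omega) :
  F = \bigcup_v (F `&` X @^-1` [set v]).
Proof. by apply/seteqP; split=> [w Fw|w [v _ []//]]; exists (X w). Qed.

Lemma discrete_rv_finite {V : finType} (X : Omega -> V) :
  (forall v, measurable (X @^-1` [set v])) -> discrete_rv X.
Proof.
move=> mX B; have -> : X @^-1` B = \bigcup_(v in B) X @^-1` [set v].
  by apply/seteqP; split=> [w Bw|w [v Bv /= ->]]; first by exists (X w).
by apply: fin_bigcup_measurable => // v _; exact: mX.
Qed.

Lemma probability_fibers {V : finType} (X : Omega -> V) (F : set Omega) :
  discrete_rv X -> measurable F ->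
  P F = (\sum_v P (F `&` X @^-1` [set v]))%E.
Proof.
move=> mX mF; rewrite {1}(fiber_decomposition X F) measure_fin_bigcup //=.
- rewrite [RHS]fsbig_seq ?index_enum_uniq //.
  rewrite (_ : [set` index_enum V] = setT) //.
  by apply/seteqP; split=> v //= _; rewrite mem_index_enum.
- by move=> v v' _ _ [w [[_ /= <-] [_ /= <-]]].
- by move=> v _; exact: measurableI.
Qed.

Lemma independent_uniform_point {I : choiceType} {V : finType} (X : I -> Omega -> V)
    (s : seq I) (v : I -> V) :
  (forall i, uniform_rv P (X i)) -> mutually_independent P X -> uniq s ->
  P [set w | forall i, i \in s -> X i w = v i] = (#|V|%:R^-1 ^+ size s)%:E.
Proof.
move=> uX iX us.
have := iX [fset i in s]%fset (fun i => [set v i]).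
under [in RHS]eq_bigr => i _ do rewrite (uX i).2.
rewrite prodEFin big_const_seq count_predT -[size _]/(#|` _|) card_fseq.
rewrite undup_id // iter_mulr_1 => <-.
congr (P _); apply/seteqP; split=> w /= Xw i.
  by rewrite /= !inE; exact: Xw.
by move=> si; apply: Xw; rewrite /= !inE.
Qed.

Lemma constant_event (Q : Prop) :
  [set w : Omega | Q] = if `[< Q >] then setT else set0.
Proof. by case: asboolP => Qh; apply/seteqP; split. Qed.

Lemma measurable_constant (Q : Prop) : measurable [set w : Omega | Q].
Proof. by rewrite constant_event; case: ifP. Qed.

Section RandomMapping.
Variables (V : finType) (S : Type) (f : V -> S -> S) (h0 : S).
Variables (H : nat -> Omega -> S) (Y : nat -> Omega -> V).
Hypothesis H0 : forall w, H 0%N w = h0.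
Hypothesis HS : forall k w, H k.+1 w = f (Y k w) (H k w).
Hypothesis mY : forall k, discrete_rv (Y k).

Lemma random_mapping_fiber k (E : set S) (y : V) :
  H k.+1 @^-1` E `&` Y k @^-1` [set y] =
  H k @^-1` (f y @^-1` E) `&` Y k @^-1` [set y].
Proof. by apply/seteqP; split=> w /= [Ew yw]; split=> //; move: Ew; rewrite HS yw. Qed.

Lemma discrete_random_mapping k : discrete_rv (H k).
Proof.
elim: k => [|k IHk] E.
  rewrite (_ : _ @^-1` _ = [set w | E h0]); first exact: measurable_constant.
  by apply/funext => w /=; rewrite H0.
rewrite (fiber_decomposition (Y k) (_ @^-1` _)).
apply: fin_bigcup_measurable => // y _; rewrite random_mapping_fiber.
by apply: measurableI; [exact: IHk|exact: mY].
Qed.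

Hypothesis innovation : forall k y (E : set S),
  P (H k @^-1` E `&` Y k @^-1` [set y]) = (P (H k @^-1` E) * (#|V|%:R^-1)%:E)%E.

(** Each [Y k] is uniform and independent of [H k] only, which says nothing of
    the joint law of the [Y k]; the law of [H k] is nevertheless the one that
    independent inputs would give, by conditioning on the last of them. *)
Lemma law_random_mapping k (E : set S) :
  P (H k @^-1` E) =
  (#|[pred t : k.-tuple V | `[< E (foldr f h0 t) >]]|%:R / #|V|%:R ^+ k)%:E.
Proof.
elim: k E => [|k IHk] E.
  rewrite expr0 divr1 (eq_card (_ : _ =i [pred t | `[< E h0 >]])); last first.
    by move=> t; rewrite !inE tuple0.
  have -> : H 0 @^-1` E = [set w | E h0] by apply/funext => w /=; rewrite H0.
  rewrite constant_event; case: `[< E h0 >].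
    by rewrite probability_setT eq_cardT // -cardT card_tuple expn0.
  by rewrite measure0 eq_card0.
have mE : measurable (H k.+1 @^-1` E) by exact: discrete_random_mapping.
rewrite (probability_fibers (mY k) mE).
under eq_bigr => y _ do rewrite random_mapping_fiber innovation IHk -EFinM.
rewrite sumEFin; congr EFin.
rewrite (card_tuple_cons k (fun s => `[< E (foldr f h0 s) >])) natr_sum mulr_suml.
by apply: eq_bigr => y _; rewrite exprSr invfM mulrA.
Qed.

End RandomMapping.

Section IidPast.
Variables (V : finType) (v0 : V) (A : nat -> Omega -> V).
Hypotheses (uA : forall r, uniform_rv P (A r)) (iA : mutually_independent P A).

Lemma past_event k (t : k.-tuple V) :
  [set w | past (A^~ w) k = t] =
  [set w | forall i, i \in iota 0 k -> A i w = nth v0 (rev t) i].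
Proof.
apply/seteqP; split=> w /= Aw.
  by move=> i; rewrite mem_iota /= => lti; rewrite -Aw revK nth_mkseq.
apply: (can_inj revK); rewrite revK.
apply: (@eq_from_nth _ v0) => [|i]; rewrite size_mkseq; first by rewrite size_rev size_tuple.
by move=> lti; rewrite nth_mkseq // Aw // mem_iota.
Qed.

Lemma discrete_past k : discrete_rv (fun w => past (A^~ w) k).
Proof.
apply: (@discrete_random_mapping V _ cons [::] (fun k w => past (A^~ w) k) A) => //.
- by move=> r w; exact: pastS.
- by move=> r; case: (uA r).
Qed.

Lemma law_past k (E : set (seq V)) :
  P [set w | E (past (A^~ w) k)] =
  (#|[pred t : k.-tuple V | `[< E t >]]|%:R / #|V|%:R ^+ k)%:E.
Proof.
have szP w : size (past (A^~ w) k) == k by rewrite size_past.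
pose T w : k.-tuple V := Tuple (szP w).
have TE t : T @^-1` [set t] = [set w | past (A^~ w) k = t].
  by apply/seteqP; split=> w /=; [move=> <-|move=> e; exact: val_inj].
have dT : discrete_rv T.
  by apply: discrete_rv_finite => t; rewrite TE; exact: (discrete_past k [set (t : seq V)]).
rewrite (probability_fibers dT); last exact: (discrete_past k E).
rewrite (eq_bigr (fun t : k.-tuple V => ((if `[< E t >] then 1 else 0) / #|V|%:R ^+ k)%:E)).
  rewrite sumEFin -mulr_suml -big_mkcond /=; congr (_ / _)%:E.
  by rewrite -sum1_card natr_sum; apply: eq_big => t.
move=> t _.
have -> : [set w | E (past (A^~ w) k)] `&` T @^-1` [set t] =
    if `[< E t >] then [set w | past (A^~ w) k = t] else set0.
  rewrite TE; case: asboolP => Et; apply/seteqP; split=> w //=.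
  - by case.
  - by move=> e; rewrite e.
  - by case=> + e; rewrite e.
case: ifP => _; last by rewrite measure0 mul0r.
rewrite past_event (independent_uniform_point (nth v0 (rev t)) uA iA) ?iota_uniq //.
by rewrite size_iota mul1r exprVn.
Qed.

End IidPast.

End Laws.

(** * Finite-dimensional laws determine the law of a process *)

Section SameDistribution.
Local Open Scope classical_set_scope.
Context {R : realType} {V : Type}.
Context {d : measure_display} {Omega : measurableType d} (P : probability Omega R).
Context {d' : measure_display} {Omega' : measurableType d'} (P' : probability Omega' R).
Variables (X : nat -> Omega -> V) (X' : nat -> Omega' -> V).

(** The cylinders over the pasts are closed under intersection and generate
    the path sigma-algebra, while the path events of equal probability form a
    Dynkin system. *)
Lemma same_distribution_past :
  (forall k, discrete_rv (fun w => past (X^~ w) k.+1)) ->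
  (forall k, discrete_rv (fun w => past (X'^~ w) k.+1)) ->
  (forall k (E : set (seq V)),
     P [set w | E (past (X^~ w) k.+1)] = P' [set w | E (past (X'^~ w) k.+1)]) ->
  same_distribution P X P' X'.
Proof.
move=> mX mX' eqPP'.
pose cyl := [set C : set (nat -> V) |
  exists k (E : set (seq V)), C = [set x | E (past x k.+1)]].
have cylI : setI_closed cyl.
  move=> _ _ [k [E ->]] [k' [E' ->]]; exists (maxn k k').
  exists [set s | E (drop ((maxn k k').+1 - k.+1) s) /\
                  E' (drop ((maxn k k').+1 - k'.+1) s)].
  by apply/funext => x /=; rewrite !drop_past ?ltnS ?leq_maxl ?leq_maxr.
pose D := [set C : set (nat -> V) | [/\ measurable [set w | C (X^~ w)],
  measurable [set w | C (X'^~ w)] &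
  P [set w | C (X^~ w)] = P' [set w | C (X'^~ w)]]].
have dD : dynkin D.
  split.
  - split; [exact: measurableT|exact: measurableT|].
    exact: etrans (probability_setT P) (esym (probability_setT P')).
  - move=> C [mC mC' eC]; split; try exact: measurableC.
    rewrite -[[set w | _]]/(~` [set w | C (X^~ w)]).
    rewrite -[[set w | (~` C) (X'^~ w)]]/(~` [set w | C (X'^~ w)]).
    by rewrite !probability_setC // eC.
  - move=> F tF DF.
    have pre (W : Type) (Z : W -> nat -> V) :
        [set w | (\bigcup_k F k) (Z w)] = \bigcup_k [set w | F k (Z w)] by [].
    have mF k : measurable [set w | F k (X^~ w)] by case: (DF k).
    have mF' k : measurable [set w | F k (X'^~ w)] by case: (DF k).
    have tr (W : Type) (Z : W -> nat -> V) : trivIset setT (fun k => [set w | F k (Z w)]).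
      by move=> i j _ _ [w [/= Fi Fj]]; apply: tF => //; exists (Z w).
    split; rewrite /= ?pre; try exact: bigcupT_measurable.
    rewrite !measure_bigcup //.
    by apply: eq_eseriesr => k _; case: (DF k).
have cylD : cyl `<=` D.
  by move=> _ [k [E ->]]; split; [exact: mX|exact: mX'|exact: eqPP'].
move=> B mB; suff [] : D B by [].
have : <<d cyl >> B.
  rewrite setI_closed_g_dynkin_g_sigma_algebra //; move: B mB.
  apply: smallest_sub; first exact: smallest_sigma_algebra.
  move=> _ [r [B ->]]; apply: sub_sigma_algebra; exists r.
  exists [set s | if s is v :: _ then B v else False].
  by apply/funext => x /=; rewrite pastS.
by apply.
Qed.

End SameDistribution.

(** * The laws of the two processes *)

Section TwoChains.
Import Order.TTheory GRing.Theory Num.Theory.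
Local Open Scope ring_scope.
Local Open Scope classical_set_scope.
Variables (p n b : nat).
Hypotheses (p_gt0 : (0 < p)%N) (p_dvd_b : (p %| b)%N).
Notation V := {ffun 'I_n.+1 -> 'I_b.+1}.
Context {d : measure_display} {Omega : measurableType d} {R : realType}.
Variable (P : probability Omega R).

Lemma A_plusE : A_plus p b.+1 = (b %/ p * p.-1)%N%:R.
Proof.
have p0 : p%:R != 0 :> rat by rewrite pnatr_eq0 -lt0n.
rewrite /A_plus -[in LHS](divnK p_dvd_b) -natr1 addrK !natrM -subn1 natrB //.
by field.
Qed.

Lemma carry_step_unique (c c' : nat) (y : V) :
  (exists s : 'I_b.+1, c%:R + \sum_(i < n.+1) (y i)%:R + A_plus p b.+1 =
     c'%:R * b.+1%:R + s%:R :> rat) ->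
  c' = carry_step p c y.
Proof.
case=> s; rewrite A_plusE -natr_sum -!natrD -natrM -natrD => /eqP.
by rewrite eqr_nat /carry_step => /eqP ->; rewrite divnMDl // divn_small // addn0.
Qed.

(** The list of all carries so far is a chain driven by the columns of digits:
    the given independence is from the whole past of the carries, so that past
    has to be the state. *)
Lemma law_carries (kappa : nat -> Omega -> carry_state p n.+1) :
  carries_process b.+1 P kappa -> (forall w, kappa 0%N w = 0%N :> nat) ->
  forall k, discrete_rv (fun w => past (fun r => kappa r w : nat) k.+1) /\
  forall E : set (seq nat),
  P [set w | E (past (fun r => kappa r w : nat) k.+1)] =
  (#|[pred t : k.-tuple V | `[< E (suffix_map (@carry p n b) t) >]]|%:R /
   #|V|%:R ^+ k)%:E.
Proof.
move=> [dkappa [Y Yprop]] kappa0.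
pose Y' k w : V := [ffun i => Y k i w].
pose f (y : V) (h : seq nat) := carry_step p (head 0%N h) y :: h.
pose H k w := past (fun r => kappa r w : nat) k.+1.
have H0 w : H 0%N w = [:: 0%N] by rewrite /H pastS kappa0.
have headH k w : head 0%N (H k w) = kappa k w by rewrite /H pastS.
have HS k w : H k.+1 w = f (Y' k w) (H k w).
  rewrite /f headH /H pastS; congr (_ :: _).
  have [_ _ _ /(_ w) [s es]] := Yprop k; apply: carry_step_unique; exists s.
  by rewrite -es; congr (_ + _ + _); apply: eq_bigr => i _; rewrite ffunE.
have Y'E k y : Y' k @^-1` [set y] =
    [set w | forall i, i \in enum 'I_n.+1 -> Y k i w = y i].
  apply/seteqP; split=> w /=; first by move=> <- i _; rewrite ffunE.
  by move=> e; apply/ffunP=> i; rewrite ffunE e ?mem_enum.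
have PY' k y : P (Y' k @^-1` [set y]) = (#|{: V}|%:R^-1)%:E.
  have [uY iY _ _] := Yprop k.
  rewrite Y'E (independent_uniform_point y uY iY) ?enum_uniq //.
  by rewrite size_enum_ord card_ffun !card_ord natrX exprVn.
have dY' k : discrete_rv (Y' k).
  have [uY _ _ _] := Yprop k.
  apply: discrete_rv_finite => y.
  have -> : Y' k @^-1` [set y] = \bigcap_(i in setT) (Y k i @^-1` [set y i]).
    rewrite Y'E; apply/seteqP; split=> w /= e i; first by move=> _; apply: e; rewrite mem_enum.
    by move=> _; exact: e.
  by apply: fin_bigcap_measurable => // i _; case: (uY i) => + _; apply.
have foldrE (t : seq V) : foldr f [:: 0%N] t = suffix_map (@carry p n b) t.
  by elim: t => //= y t ->; rewrite /f; case: t.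
move=> k; split; first exact: (discrete_random_mapping H0 HS dY').
move=> E; rewrite [LHS](law_random_mapping H0 HS dY').
  by congr (_%:R / _)%:E; apply: eq_card => t; rewrite !inE foldrE.
move=> {k E} k y E; have [_ _ iY _] := Yprop k.
pose G (F : {ffun 'I_k.+1 -> carry_state p n.+1}) :=
  past (fun j => F (inord j) : nat) k.+1.
have HE : H k @^-1` E =
    (fun w => [ffun j : 'I_k.+1 => kappa j w]) @^-1` (G @^-1` E).
  apply/funext => w; congr E; apply: eq_past => j lejk.
  by rewrite ffunE inordK.
by rewrite HE iY PY'.
Qed.

Lemma law_descents (sigma : nat -> Omega -> Gpn p n.+1) :
  shuffle_chain b.+1 P sigma ->
  forall k, discrete_rv (fun w => past (fun r => descents (sigma r w)) k.+1) /\
  forall E : set (seq nat),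
  P [set w | E (past (fun r => descents (sigma r w)) k.+1)] =
  (#|[pred t : k.-tuple V |
      `[< E (suffix_map (fun s => descents (shuffle_prod p s)) t) >]]|%:R /
   #|V|%:R ^+ k)%:E.
Proof.
move=> [A [uA iA sigma0 sigmaS]] k.
have sigmaE r w : sigma r w = shuffle_prod p (past (A^~ w) r).
  by elim: r => [|r IHr]; rewrite ?sigma0 // sigmaS pastS /= IHr.
pose F s := suffix_map (fun s : seq V => descents (shuffle_prod p s)) s.
have pastE w : past (fun r => descents (sigma r w)) k.+1 = F (past (A^~ w) k).
  elim: k => [|k IHk]; first by rewrite pastS sigmaE.
  by rewrite pastS IHk sigmaE pastS.
split=> [E|E].
  by under eq_fun => w do rewrite pastE; exact: (discrete_past uA k (F @^-1` E)).
under eq_fun => w do rewrite pastE.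
exact: (law_past [ffun=> ord0] uA iA k (F @^-1` E)).
Qed.

End TwoChains.

Theorem theorem1p8 (p n b : nat) (hp : (1 <= p)%N) (hn : (1 <= n)%N)
  (hb : (2 <= b)%N) (hbp : b = 1 %[mod p])
  (R : realType)
  (d : measure_display) (Omega : measurableType d) (P : probability Omega R)
  (kappa : nat -> Omega -> carry_state p n)
  (hkappa : carries_process b P kappa)
  (hkappa0 : forall w : Omega, (kappa 0%N w = 0%N :> nat))
  (d' : measure_display) (Omega' : measurableType d') (P' : probability Omega' R)
  (sigma : nat -> Omega' -> Gpn p n)
  (hsigma : shuffle_chain b P' sigma) :
  same_distribution P (fun r w => nat_of_ord (kappa r w))
                    P' (fun r w => descents (sigma r w)).
Proof.
case: n hn kappa hkappa hkappa0 sigma hsigma => // n _ kappa hkappa kappa0 sigma hsigma.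
case: b hb hbp hkappa hsigma => // b _ hbp hkappa hsigma.
have p_dvd_b : p %| b.
  by have /eqP := hbp; rewrite -[1]add0n -addn1 eqn_modDr mod0n.
have lawK := law_carries hp p_dvd_b hkappa kappa0.
have lawD := law_descents hsigma.
apply: same_distribution_past => [k|k|k E].
- by case: (lawK k).
- by case: (lawD k).
- rewrite (lawK k).2 (lawD k).2.
  by rewrite (@card_descents_carry p n b hp p_dvd_b k (fun s => `[< E s >])).
Qed.
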